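(* Let $p$ be an odd prime, $n\ge 2$ an integer, $F$ the finite field of order $p^n$ and $L$ its quadratic extension (of order $p^{2n}$). Let $k\ge 2$ be an integer with $k<\frac{p}{2}+1$, and suppose $s=1+k(p^n-1)$ is an invertible Niho exponent over $L$. Let $d_1=\gcd(k,p^n+1)$ and $d_2=\gcd(k-1,p^n+1)$. If $d_1+d_2\ge 5$, then the Weil spectrum $\{W_{L,s}(a): a\in L^\times\}$ has at least five elements. Moreover, four of these values are $0$, $-p^n$, $2\alpha p^n$ and $(2\beta+1)p^n$ for some integers $\alpha,\beta\ge 1$.
   Context: $\mu(x)=e^{2\pi i\,\mathrm{Tr}_{L/\mathbb{F}_p}(x)/p}$ is the canonical additive character of $L$, and $W_{L,s}(a)=\sum_{x\in L}\mu(x^s-ax)$ for $a\in L$. The exponent $s$ is invertible over $L$ if $\gcd(s,p^{2n}-1)=1$. A Niho exponent over $L$ is an integer $s$ not congruent to a power of $p$ modulo $p^{2n}-1$ with $s\equiv p^j\pmod{p^n-1}$ for some $j\ge0$. *)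

(* Defs.v *)
From HB Require Import structures.
From mathcomp Require Import all_boot all_order all_fingroup all_algebra all_field.
From mathcomp Require Import finmap.
From mathcomp Require Import complex.
From mathcomp Require Import reals trigo.

Set Implicit Arguments.
Unset Strict Implicit.
Unset Printing Implicit Defensive.

Import Order.TTheory GRing.Theory Num.Theory.
Local Open Scope ring_scope.

(* [pPrimeCharType charL] is [L] viewed as an extension of its prime field
   ['F_p].  [galTrace] takes its values in the line spanned by 1, so the
   scalar picked below always exists and is unique, see [abs_traceE]. *)
Definition abs_trace (p : nat) (L : finFieldType) (charL : p \in [pchar L])
    (x : L) : 'F_p :=
  let E := pPrimeCharType charL in
  odflt 0 [pick c : 'F_p | c%:A == galTrace 1 {: E} (x : E)].

Lemma abs_traceE (p : nat) (L : finFieldType) (charL : p \in [pchar L])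
    (x : L) :
  (abs_trace charL x)%:A = galTrace 1 {: pPrimeCharType charL} x.
Proof.
rewrite /abs_trace /=; case: pickP => [c /eqP //|none].
have gal1 : galois 1 {: pPrimeCharType charL}.
  by apply: finField_galois; exact: sub1v.
have /vlineP[c def_c] := mem_galTrace gal1 (memvf (x : pPrimeCharType charL)).
by have := none c; rewrite -def_c eqxx.
Qed.

Section Weil.

Variables (R : realType) (p : nat) (L : finFieldType).
Variable charL : p \in [pchar L].

Definition cis (t : R) : R[i] := (cos t +i* sin t)%C.

(* The additive character exp(2 pi i Tr(x) / p); the trace is represented by
   its residue in {0, ..., p - 1}. *)
Definition add_char (x : L) : R[i] :=
  cis (2 * pi * (abs_trace charL x : nat)%:R / p%:R).

Definition weil_sum (s : nat) (a : L) : R[i] :=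
  \sum_(x : L) add_char (x ^+ s - a * x).

Definition weil_spectrum (s : nat) : {fset R[i]} :=
  [fset weil_sum s a | a in [pred a : L | a != 0]]%fset.

End Weil.

(* Exponents over the field of order p ^ (2 * n). *)
Definition invertible_exponent (p n s : nat) : bool :=
  coprime s (p ^ (2 * n) - 1)%N.

Definition niho_exponent (p n s : nat) : Prop :=
  (~ exists j : nat, s = p ^ j %[mod p ^ (2 * n) - 1])%N /\
  (exists j : nat, s = p ^ j %[mod p ^ n - 1])%N.

(* Main.v *)
Require Import Defs.
From mathcomp Require Import all_boot all_order all_fingroup all_algebra.
From mathcomp Require Import all_solvable all_field.
From mathcomp Require Import finmap complex reals trigo.
From mathcomp Require Import zify ring lra.

(* Put q = p^n, let U be the group of order q + 1 in L^* and let N(a) be the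
   number of u in U with u^k + u^(1-k) = a + a^q u.  Averaging the Weil sum over
   the scalings x = r y with r in F^* gives W(a) = (N(a) - 1) q.

   For fixed u the equation describes a line of the F-plane L, and lines of
   different u meet in exactly one point.  Counting incidences yields
   sum N = q (q + 1) and sum N^2 = 2 q (q + 1), which force N = 0 to occur, and
   also N = 1 for some a <> 0 because N(0) = 1 and N(1) = d1 + d2 - 1 >= 4.  For
   a in U the equation factors as (u^k - a) (1 - u^(1-k) / a) = 0, so that N(a)
   can be computed there; the values d1 + d2 - 1 at a = 1, d1 + [d2 = 1] at
   a = w^k and d2 + [d1 = 1] at a = w^(k-1), with w a generator of U, are
   attained.  If d1, d2 > 1 this gives five values.

   If d1 = 1 or d2 = 1, these are only 0, 1, d and d + 1 with
   d = d1 + d2 - 1 even, and the fifth one is some N(a) with 2 <= N(a) < d.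
   Otherwise any two of the lines would lie in a pencil of at least d, so there
   would be at least (q + 1) q (d - 2) triples of distinct concurrent lines
   (t x, t y, t).  But concurrency determines t^(2k-1), hence t, from x and y,
   unless x, y are both k-th or both (k-1)-th roots of unity, so there are at
   most (q + 1)^2 + (q + 1) (d1^2 + d2^2) such triples. *)

Set Implicit Arguments.
Unset Strict Implicit.
Unset Printing Implicit Defensive.

Import Order.TTheory GRing.Theory Num.Theory.
Local Open Scope ring_scope.

(** * Additivity, Frobenius invariance and nontriviality of the absolute trace *)

Section AbsTrace.

Variables (p : nat) (L : finFieldType) (charL : p \in [pchar L]).
Local Notation E := (pPrimeCharType charL).
Local Notation tr := (abs_trace charL).

Lemma abs_traceD : {morph tr : x y / x + y}.
Proof.
move=> x y; apply: (fmorph_inj (in_alg E)); rewrite /= scalerDl !abs_traceE.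
exact: (raddfD (galTrace 1 {: E})).
Qed.

Lemma abs_trace0 : tr 0 = 0.
Proof. by apply: (addrI (tr 0)); rewrite -abs_traceD !addr0. Qed.

(** The Galois group over the prime field is generated by the [p]-th power map, and the Galois trace
    is invariant under it. *)
Lemma abs_trace_Frobenius x : tr (x ^+ p) = tr x.
Proof.
apply: (fmorph_inj (in_alg E)); rewrite /= !abs_traceE.
have [a genG Da] := finField_galois_generator (sub1v {: E}).
have := Da x (memvf _).
rewrite dimv1 card_Fp ?expn1 ?(pcharf_prime charL) // => <-.
by rewrite galTrace_gal ?memvf // ((_ =P <[a]>%g) genG) cycle_id.
Qed.

Lemma abs_trace_Frobenius_iter n x : tr (x ^+ (p ^ n)) = tr x.
Proof. by elim: n => // n IHn; rewrite expnSr exprM abs_trace_Frobenius. Qed.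

(** Dedekind independence: the sum of all automorphisms, with coefficients 1, is not the zero
    map. *)
Lemma abs_trace_neq0 : exists x, tr x != 0.
Proof.
have [x _ nz_x] := @gal_independent_contra _ _ {: E}
  [in 'Gal({: E} / 1)%g] (fun=> 1) 1%g (group1 _) (oner_neq0 _).
exists x; apply: contraNneq nz_x => tr0; apply/eqP.
by under eq_bigr do rewrite mul1r; rewrite -[LHS](abs_traceE charL) tr0 scale0r.
Qed.

End AbsTrace.

(** * The canonical additive character and its kernel *)

Section AddChar.

Variables (R : realType) (p : nat) (L : finFieldType).
Variable charL : p \in [pchar L].
Local Notation mu := (add_char R charL).

Lemma cis0 : cis 0 = 1 :> R[i].
Proof. by rewrite /cis cos0 sin0. Qed.

Lemma cisD (t u : R) : cis (t + u) = cis t * cis u.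
Proof.
rewrite /cis cosD sinD; apply/eqP; rewrite eq_complex /= addrC.
by rewrite [_ * _ + _]addrC eqxx addrC eqxx.
Qed.

Lemma cisMn (t : R) m : cis (t * m%:R) = cis t ^+ m.
Proof.
elim: m => [|m IHm]; first by rewrite mulr0 cis0.
by rewrite -natr1 mulrDr mulr1 cisD IHm exprSr.
Qed.

Lemma cis_2pi : cis (2 * pi) = 1 :> R[i].
Proof. by rewrite /cis mulr_natl cos2pi sin2pi. Qed.

Let zeta : R[i] := cis (2 * pi / p%:R).

Let p_pr : prime p. Proof. exact: pcharf_prime charL. Qed.

Lemma add_charE x : mu x = zeta ^+ (abs_trace charL x : nat).
Proof. by rewrite /add_char /zeta -cisMn mulrAC. Qed.

Lemma zeta_p : zeta ^+ p = 1.
Proof.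
by rewrite -cisMn divfK ?cis_2pi // pnatr_eq0 -lt0n prime_gt0.
Qed.

Lemma add_charD x y : mu (x + y) = mu x * mu y.
Proof.
rewrite !add_charE abs_traceD -exprD /= -[RHS](expr_mod _ zeta_p).
by congr (_ ^+ (_ %% _)); exact: Fp_cast.
Qed.

(** For odd [p] the angle 2 pi / p lies strictly between 0 and pi, so the imaginary part is
    positive. *)
Lemma zeta_neq1 : odd p -> zeta != 1.
Proof.
move=> p_odd; have p_gt2 : (2 < p)%N by rewrite odd_prime_gt2.
have p_gt0 : 0 < p%:R :> R by rewrite ltr0n prime_gt0.
have : 0 < sin (2 * pi / p%:R :> R).
  apply: sin_gt0_pi; rewrite divr_gt0 ?mulr_gt0 ?pi_gt0 //=.
  by rewrite ltr_pdivrMr // [2 * _]mulrC ltr_pM2l ?pi_gt0 // ltr_nat.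
by rewrite /zeta /cis eq_complex /= => /lt0r_neq0/negPf->; rewrite andbF.
Qed.

Lemma add_char0 : mu 0 = 1.
Proof. by rewrite add_charE abs_trace0 expr0. Qed.

Lemma add_char_eq1 x : odd p -> (mu x == 1) = (abs_trace charL x == 0).
Proof.
move=> p_odd; apply/eqP/eqP=> [|tr0]; last by rewrite add_charE tr0 expr0.
rewrite add_charE; set j := abs_trace charL x => zj.
apply/val_inj/eqP => /=; apply: contraTT (zeta_neq1 p_odd) => nz_j.
have ltjp : (j < p)%N by rewrite -{2}(Fp_cast p_pr).
have /eqP cop : coprime p j by rewrite prime_coprime // gtnNdvd // lt0n.
have j_gt0 : (0 < j)%N by rewrite lt0n.
(* Bézout for the coprime exponents [j] and [p], at both of which the power of [zeta] is 1, gives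
   [zeta = 1]. *)
have [u v uv _] := egcdnP p j_gt0.
have : zeta ^+ (v * p + gcdn j p) = 1 by rewrite -uv mulnC exprM zj expr1n.
by rewrite exprD mulnC exprM zeta_p expr1n mul1r gcdnC cop expr1 negbK => ->.
Qed.

End AddChar.

(** * The group of order [q + 1] in [L] and conjugation by the [q]-th power *)

Section UnitCircle.

Variables (L : finFieldType) (q : nat).
Hypotheses (q_gt1 : (1 < q)%N) (cardL : #|L| = (q ^ 2)%N).

(* Locked so that [inE] does not unfold membership. *)
Definition circle : {set L} := locked [set u | u ^+ q.+1 == 1].

Lemma in_circle u : (u \in circle) = (u ^+ q.+1 == 1).
Proof. by rewrite /circle -lock inE. Qed.

Lemma circleP u : reflect (u ^+ q.+1 = 1) (u \in circle).
Proof. by rewrite in_circle; apply: eqP. Qed.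

Lemma card_power_fiber_le (m : nat) (c : L) :
  (0 < m)%N -> (#|[set y | y ^+ m == c]| <= m)%N.
Proof.
move=> m_gt0; set A := [set _ | _].
have szP : size ('X^m - c%:P : {poly L}) = m.+1 by rewrite size_XnsubC.
have nzP : 'X^m - c%:P != 0 :> {poly L} by rewrite -size_poly_eq0 szP.
have rtA : all (root ('X^m - c%:P)) (enum A).
  by apply/allP => y; rewrite mem_enum inE rootE !hornerE subr_eq0.
by have := max_poly_roots nzP rtA (enum_uniq A); rewrite szP ltnS -cardE.
Qed.

Lemma expr_circle (y : L) : y != 0 -> y ^+ q.-1 \in circle.
Proof.
move=> nz_y; rewrite in_circle -exprM.
have -> : (q.-1 * q.+1)%N = #|L|.-1 by rewrite cardL; nia.
by apply/eqP/(mulfI nz_y); rewrite -exprS prednK ?expf_card ?mulr1 // cardL; nia.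
Qed.

(* The [q - 1]-th power map sends the [q^2 - 1] nonzero elements to at most
   [q + 1] values, each taken at most [q - 1] times, so both bounds are sharp. *)
Lemma circle_counts :
  #|circle| = q.+1 /\
  {in circle, forall u, #|[set y : L | y ^+ q.-1 == u]| = q.-1}.
Proof.
have leU : (#|circle| <= q.+1)%N.
  by rewrite /circle -lock card_power_fiber_le.
have leF u : (#|[set y : L | y ^+ q.-1 == u]| <= q.-1)%N.
  by apply: card_power_fiber_le; lia.
have sumF : (\sum_(u in circle) #|[set y : L | y ^+ q.-1 == u]| = q.-1 * q.+1)%N.
  transitivity (#|[set y : L | y != 0]|).
    rewrite -sum1_card.
    rewrite [RHS](partition_big (fun y => y ^+ q.-1) (mem circle)) => [|y];
      last first.
      by rewrite inE; apply: expr_circle.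
    apply: eq_bigr => u Uu; rewrite sum1_card; apply/esym/eq_card => y.
    rewrite -topredE /= !inE andbC; case: eqP => //= yu.
    apply: contraTneq Uu => y0; rewrite in_circle -yu y0 expr0n.
    have -> : (q.-1 == 0)%N = false by lia.
    by rewrite expr0n eq_sym oner_eq0.
  have := cardsC1 (0 : L); rewrite cardL => cardC.
  have -> : (q.-1 * q.+1 = (q ^ 2).-1)%N by nia.
  by rewrite -cardC; apply: eq_card => y; rewrite !inE.
have eU : #|circle| = q.+1.
  apply/eqP; rewrite eqn_leq leU -(leq_pmul2l (_ : 0 < q.-1)%N) -?sumF; last lia.
  by rewrite mulnC -sum_nat_const leq_sum.
split=> // u0 Uu0; apply/eqP; rewrite eqn_leq leF /=.
rewrite leqNgt; apply/negP => ltF.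
have : (\sum_(u in circle) #|[set y : L | y ^+ q.-1 == u]| < #|circle| * q.-1)%N.
  rewrite -sum_nat_const (bigD1 u0) // [X in (_ < X)%N](bigD1 u0) //=.
  by rewrite -addSn leq_add // leq_sum.
by rewrite sumF eU mulnC ltnn.
Qed.

Lemma card_circle : #|circle| = q.+1. Proof. exact: circle_counts.1. Qed.

Lemma card_circle_fiber u :
  u \in circle -> #|[set y : L | y ^+ q.-1 == u]| = q.-1.
Proof. exact: circle_counts.2. Qed.

Lemma circle_prim_root : exists w : L, q.+1.-primitive_root w.
Proof.
have /hasP[w _ wP] : has (q.+1).-primitive_root (enum circle).
  apply: has_prim_root => //; last by rewrite -cardE card_circle.
    by apply/allP=> u; rewrite mem_enum in_circle unity_rootE.
  exact: enum_uniq.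
by exists w.
Qed.


Lemma circle_neq0 u : u \in circle -> u != 0.
Proof. by apply: contraTneq => ->; rewrite in_circle expr0n eq_sym oner_eq0. Qed.

Lemma circle_conj u : u \in circle -> u ^+ q = u^-1.
Proof.
move=> Uu; apply: (mulfI (circle_neq0 Uu)).
by rewrite divff ?circle_neq0 // -exprS (circleP _ Uu).
Qed.

Lemma circleM u v : u \in circle -> v \in circle -> u * v \in circle.
Proof. by rewrite !in_circle exprMn => /eqP-> /eqP->; rewrite mulr1. Qed.

Lemma circleV u : (u^-1 \in circle) = (u \in circle).
Proof. by rewrite !in_circle exprVn -[1 in LHS]invr1 (inj_eq invr_inj). Qed.

Lemma circle1 : 1 \in circle.
Proof. by rewrite in_circle expr1n. Qed.

Lemma circleX u m : u \in circle -> u ^+ m \in circle.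
Proof. by rewrite !in_circle exprAC => /eqP->; rewrite expr1n. Qed.

Lemma conjK (x : L) : (x ^+ q) ^+ q = x.
Proof. by rewrite -exprM -[RHS]expf_card cardL mulnn. Qed.

Hypothesis q_odd : odd q.
(** This section knows [q] only as a number; for a power of the characteristic the assumption is
    supplied by [expr_pchar_powD]. *)
Hypothesis conjD : {morph (fun x : L => x ^+ q) : x y / x + y}.

Lemma conjN (x : L) : (- x) ^+ q = - x ^+ q.
Proof. by rewrite exprNn -signr_odd q_odd mulN1r. Qed.

Lemma conjB (x y : L) : (x - y) ^+ q = x ^+ q - y ^+ q.
Proof. by rewrite conjD conjN. Qed.

Lemma circleN u : (- u \in circle) = (u \in circle).
Proof. by rewrite !in_circle exprNn -signr_odd /= q_odd mul1r. Qed.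

(** * The Niho equation: lines, their intersections, moments of the root count *)

Variable k : nat.

(** The second term is u^(1-k), written with natural exponents. *)
Definition niho_fun (u : L) : L := u ^+ k + u * u^-1 ^+ k.

Definition niho_eq (a u : L) : bool := niho_fun u == a + a ^+ q * u.

Definition niho_roots (a : L) : {set L} := [set u in circle | niho_eq a u].

(** Conjugation swaps the two terms up to the factor [u]. Hence the equation at [u] is conjugate to
    its own multiple by 1/u and imposes one linear condition over F, not two. *)
Lemma niho_fun_conj u : u \in circle -> niho_fun u ^+ q = niho_fun u / u.
Proof.
move=> Uu; have uV : u^-1 ^+ q = u by rewrite exprVn circle_conj ?invrK.
rewrite /niho_fun conjD exprMn [u ^+ k ^+ q]exprAC [u^-1 ^+ k ^+ q]exprAC uV.
by rewrite circle_conj // mulrDl mulrAC divff ?circle_neq0 // mul1r addrC mulrC.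
Qed.

(** One solution is [a = u ^+ k], so the solutions are a translate of the kernel of b + b^q u. This
    kernel is 0 and the [q - 1] roots of b^(q-1) = -1/u, where -1/u is in the circle because [q] is
    odd. *)
Lemma card_niho_line u : u \in circle -> #|[set a | niho_eq a u]| = q.
Proof.
move=> Uu; have nz_u := circle_neq0 Uu.
have -> : [set a | niho_eq a u] =
    [set u ^+ k + b | b in [set b | b + b ^+ q * u == 0]].
  apply/setP=> a; rewrite inE -[a in RHS](addrNK (u ^+ k)) [_ + u ^+ k]addrC.
  rewrite (mem_imset _ _ (addrI _)) inE /niho_eq /niho_fun conjB.
  rewrite [_ ^+ k ^+ q]exprAC (circle_conj Uu) eq_sym -subr_eq0.
  by congr (_ == 0); ring.
rewrite card_imset; last exact: addrI.
have -> : [set b | b + b ^+ q * u == 0] =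
    0 |: [set b : L | b ^+ q.-1 == - u^-1].
  apply/setP=> b; rewrite !inE; have [->|nz_b] /= := eqVneq b 0.
    by rewrite expr0n gtn_eqF ?(ltnW q_gt1) //= mul0r addr0 eqxx.
  rewrite -[in LHS](prednK (ltnW q_gt1)) exprS -mulrA -[X in X + _]mulr1 -mulrDr.
  rewrite mulf_eq0 (negPf nz_b) /= addrC addr_eq0 -[RHS](inj_eq (mulIf nz_u)).
  by rewrite mulNr mulVf.
rewrite cardsU1 card_circle_fiber ?circleN ?circleV // inE expr0n.
have -> : (q.-1 == 0)%N = false by lia.
by rewrite eq_sym oppr_eq0 invr_eq0 (negPf nz_u) /=; lia.
Qed.

(** Subtracting the equations forces [a ^+ q] to be the slope [c], so [a = g u - u * c]. That this
    [a] is a solution is the identity [c ^+ q = g u - u * c], a consequence of [niho_fun_conj]. *)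
Lemma card_niho_point u v : u \in circle -> v \in circle -> u != v ->
  #|[set a | niho_eq a u && niho_eq a v]| = 1%N.
Proof.
move=> Uu Uv neq_uv; have [nz_u nz_v] := (circle_neq0 Uu, circle_neq0 Uv).
have nz_uv : u - v != 0 by rewrite subr_eq0.
set g := niho_fun; pose c := (g u - g v) / (u - v).
have cE : c * (u - v) = g u - g v by rewrite divfK.
have cC : c ^+ q = g u - u * c.
  apply: (mulIf nz_uv).
  have -> : c ^+ q = (g u / u - g v / v) / (u^-1 - v^-1).
    by rewrite /c exprMn exprVn !conjB !niho_fun_conj // !circle_conj.
  have -> : (g u - u * c) * (u - v) = g u * (u - v) - u * (g u - g v).
    by rewrite -cE; ring.
  field.
  by rewrite nz_u nz_v mulN1r subr_eq0 eq_sym.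
apply/eqP/cards1P; exists (g u - u * c); apply/setP=> a; rewrite !inE.
apply/andP/eqP=> [[/eqP au /eqP av]|->].
  have -> : c = a ^+ q.
    by apply: (mulIf nz_uv); rewrite cE /g au av; ring.
  by rewrite /g au; ring.
rewrite /niho_eq -cC conjK cC; split; apply/eqP; first by rewrite -/g; ring.
by rewrite -/g -[g v](subKr (g u)) -cE; ring.
Qed.

Lemma sum_card_niho_roots : (\sum_a #|niho_roots a| = q.+1 * q)%N.
Proof.
transitivity (\sum_(u in circle) #|[set a | niho_eq a u]|)%N.
  under eq_bigr do rewrite -sum1dep_card big_mkcondr /=.
  rewrite exchange_big /=; apply: eq_bigr => u _.
  by rewrite -big_mkcond sum1dep_card.
rewrite -card_circle -sum_nat_const; apply: eq_bigr => u; exact: card_niho_line.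
Qed.

(** Counts pairs of roots: for each [u] the diagonal pair occurs for [q] values of [a], and each of
    the [q] pairs with [v != u] for one. *)
Lemma sum_sqr_card_niho_roots :
  (\sum_a #|niho_roots a| ^ 2 = 2 * (q.+1 * q))%N.
Proof.
transitivity (\sum_(u in circle) \sum_(v in circle)
    #|[set a | niho_eq a u && niho_eq a v]|)%N.
  transitivity (\sum_a \sum_(u in circle) \sum_(v in circle)
      (niho_eq a u && niho_eq a v : nat))%N.
    apply: eq_bigr => a _; rewrite -mulnn -sum1dep_card big_mkcondr /= big_distrl /=.
    apply: eq_bigr => u _; rewrite big_distrr /=; apply: eq_bigr => v _.
    by case: niho_eq; case: niho_eq.
  rewrite exchange_big /=; apply: eq_bigr => u _.
  rewrite exchange_big /=; apply: eq_bigr => v _.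
  by rewrite -sum1dep_card [RHS]big_mkcond; apply: eq_bigr => a _; case: ifP.
transitivity (\sum_(u in circle) (q + q))%N; last first.
  by rewrite sum_nat_const card_circle; lia.
apply: eq_bigr => u Uu; rewrite (bigD1 u) //=; congr (_ + _)%N.
  have -> : [set a | niho_eq a u && niho_eq a u] = [set a | niho_eq a u].
    by apply/setP=> a; rewrite !inE andbb.
  exact: card_niho_line.
have -> : q = #|circle :\ u| by have := cardsD1 u circle; rewrite Uu card_circle; lia.
rewrite -sum1_card; apply: eq_big => v; first by rewrite !inE andbC.
by case/andP=> Uv nvu; rewrite card_niho_point // eq_sym.
Qed.


(** Multiplied by [u ^+ k.-1], the equation becomes polynomial of degree [2 * k - 1] in [u]. *)
Lemma card_niho_roots_le a : (1 < k)%N -> (#|niho_roots a| <= 2 * k - 1)%N.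
Proof.
move=> k_gt1; pose r : {poly L} := a ^+ q *: 'X^k + a *: 'X^(k.-1) - 1%:P.
pose P : {poly L} := 'X^(2 * k - 1) - r.
have szr : (size r <= 2 * k - 1)%N.
  rewrite (leq_trans (size_polyD _ _)) // geq_max size_polyN size_polyC oner_eq0.
  apply/andP; split; last by rewrite /=; lia.
  rewrite (leq_trans (size_polyD _ _)) // geq_max.
  by rewrite !(leq_trans (size_scale_leq _ _)) // size_polyXn; lia.
have szP : size P = (2 * k - 1).+1.
  by rewrite size_polyDl size_polyXn // size_polyN ltnS.
have nzP : P != 0 by rewrite -size_poly_eq0 szP.
have rtP : all (root P) (enum (niho_roots a)).
  apply/allP => u; rewrite mem_enum inE => /andP[Uu /eqP au].
  have nz_u := circle_neq0 Uu.
  have uk : u ^+ k = u ^+ k.-1 * u by rewrite -exprSr prednK // ltnW.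
  have u2k : u ^+ (2 * k - 1) = u ^+ k.-1 * u ^+ k.
    by rewrite -exprD; congr (_ ^+ _); lia.
  have uVk : u * u^-1 ^+ k * u ^+ k.-1 = 1.
    by rewrite mulrAC [u * _]mulrC -uk -exprMn divff ?expr1n.
  rewrite rootE !hornerE u2k; apply/eqP.
  have : (niho_fun u - (a + a ^+ q * u)) * u ^+ k.-1 = 0 by rewrite au subrr mul0r.
  by rewrite /niho_fun 2!mulrDl uVk uk => <-; ring.
have := max_poly_roots nzP rtP (enum_uniq _).
by rewrite szP ltnS -cardE.
Qed.

(* If [N >= 1] everywhere, summing [(N - 1) (q - N) >= 0] gives [- q >= 0]. *)
Lemma exists_no_niho_root :
  (1 < k)%N -> (2 * k - 1 <= q)%N -> exists a, #|niho_roots a| = 0%N.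
Proof.
move=> k_gt1 le_kq; suff /existsP[a /eqP] : [exists a, #|niho_roots a| == 0%N].
  by exists a.
apply: contraT => /existsPn/= no0.
have : (\sum_(a : L) (#|niho_roots a| ^ 2 + q) <=
        \sum_(a : L) (q.+1 * #|niho_roots a|))%N.
  apply: leq_sum => a _; move: (no0 a) (leq_trans (card_niho_roots_le a k_gt1) le_kq).
  by case: #|_| => // N _ ltNq; have := leq_mul (leqnn N) ltNq; lia.
rewrite big_split /= sum_nat_const cardL sum_sqr_card_niho_roots.
by rewrite -big_distrr /= sum_card_niho_roots; nia.
Qed.

(* The moments give [sum N (N - 2) = 0], where only [N = 1] contributes
   negatively. *)
Lemma exists_single_niho_root b : #|niho_roots 0| = 1%N ->
  (4 <= #|niho_roots b|)%N -> exists2 a, a != 0 & #|niho_roots a| = 1%N.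
Proof.
move=> N0 Nb; suff /existsP[a /andP[nz_a /eqP Na]] :
    [exists a, (a != 0) && (#|niho_roots a| == 1%N)] by exists a.
apply: contraT => /existsPn/= no1.
have nz_b : b != 0 by apply: contraTneq Nb => ->; rewrite N0.
have : (\sum_(a : L | (a != 0%R) && (a != b)) 2 * #|niho_roots a| <=
        \sum_(a : L | (a != 0%R) && (a != b)) #|niho_roots a| ^ 2)%N.
  apply: leq_sum => a /andP[nz_a _]; have := no1 a; rewrite nz_a.
  by case: #|_| => [|[|N]] //= _; nia.
have := sum_sqr_card_niho_roots; have := sum_card_niho_roots.
rewrite (bigD1 0) // (bigD1 b) //= N0 => S1.
rewrite (bigD1 0) // (bigD1 b) //= N0 -big_distrr /= => S2 leS.
have absurd N X Y Z : (4 <= N -> 1 + (N + X) = Z ->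
    1 ^ 2 + (N ^ 2 + Y) = 2 * Z -> 2 * X <= Y -> false)%N.
  by move=> geN; rewrite -!mulnn; have := leq_mul geN (leqnn N); lia.
exact: absurd Nb S1 S2 leS.
Qed.

(** * Root counts on the circle by means of a generator [w] *)

Section PrimRoot.

Variable w : L.
Hypothesis w_prim : q.+1.-primitive_root w.

Lemma circle_prim u : u \in circle -> exists i, u = w ^+ i.
Proof. by move=> /circleP/(prim_rootP w_prim)[i ->]; exists i. Qed.

Lemma prim_circle i : w ^+ i \in circle.
Proof. by apply/circleX; rewrite in_circle (prim_expr_order w_prim). Qed.

Lemma circle_gcd u m : u \in circle -> (u ^+ m == 1) = (u ^+ gcdn m q.+1 == 1).
Proof.
case/circle_prim=> i ->; rewrite -!exprM -!(prim_order_dvd w_prim).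
rewrite muln_gcdr dvdn_gcd; apply/idP/andP=> [-> |[] //].
by rewrite dvdn_mull.
Qed.

Lemma circle_coprime_inj m :
  coprime m q.+1 -> {in circle &, injective (fun u => u ^+ m)}.
Proof.
move=> /eqP co_m u v Uu Uv /= uv; have nz_v := circle_neq0 Uv.
apply/eqP; rewrite -subr_eq0 -(mulIr_eq0 _ (mulIf (invr_neq0 nz_v))) mulrBl divff //.
have := @circle_gcd (u / v) m; rewrite circleM ?circleV // co_m expr1 subr_eq0.
by move=> <- //; rewrite exprMn exprVn uv divff ?expf_neq0.
Qed.

(** X^g - 1 has at most [g] roots, and the powers of w^((q+1)/g) provide that many. *)
Lemma card_circle_roots1 m :
  (0 < m)%N -> #|[set u in circle | u ^+ m == 1]| = gcdn m q.+1.
Proof.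
move=> m_gt0; set g := gcdn m q.+1.
have g_gt0 : (0 < g)%N by rewrite gcdn_gt0 m_gt0.
have g_q : (g %| q.+1)%N by apply: dvdn_gcdr.
have eqg : [set u in circle | u ^+ m == 1] = [set u | u ^+ g == 1].
  apply/setP=> u; rewrite !inE; apply/andP/idP=> [[Uu]|/eqP ug].
    by rewrite circle_gcd.
  have Uu : u \in circle by rewrite in_circle -(divnK g_q) mulnC exprM ug expr1n.
  by rewrite circle_gcd // ug.
rewrite eqg; apply/eqP; rewrite eqn_leq card_power_fiber_le //=.
have z_prim := dvdn_prim_root w_prim g_q; set z := w ^+ _ in z_prim.
rewrite -{1}(card_ord g) -(card_imset _ (_ : injective (fun j : 'I_g => z ^+ j))).
  apply/subset_leq_card/subsetP=> _ /imsetP[j _ ->].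
  by rewrite inE exprAC (prim_expr_order z_prim) expr1n.
move=> i j /eqP; rewrite (eq_prim_root_expr z_prim) !modn_small //.
by move/eqP/val_inj.
Qed.

(** In a cyclic group of order [q + 1] the [m]-th powers are the [w ^+ i] with [i] divisible by the
    gcd, and each fibre is a coset of the [m]-th roots of unity. The divisibility acts as a factor 0
    or 1. *)
Lemma card_circle_roots m i : (0 < m)%N ->
  #|[set u in circle | u ^+ m == w ^+ i]| =
  ((gcdn m q.+1 %| i) * gcdn m q.+1)%N.
Proof.
move=> m_gt0; set g := gcdn m q.+1.
have g_q : (g %| q.+1)%N by apply: dvdn_gcdr.
case: (boolP (g %| i)%N) => [|ndvd].
  case/dvdnP=> c ->; have [s t st _] := egcdnP q.+1 m_gt0.
  (* By Bézout [s * m] is [g] modulo [q + 1], so [v] is an [m]-th root of [w ^+ (c * g)]. *)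
  pose v := w ^+ (s * c); have Uv : v \in circle by apply: prim_circle.
  have nz_v := circle_neq0 Uv.
  have vm : v ^+ m = w ^+ (c * g).
    rewrite -exprM mulnAC st mulnDl exprD mulnAC mulnC exprM.
    by rewrite (prim_expr_order w_prim) expr1n mul1r mulnC.
  rewrite mul1n -[RHS](card_circle_roots1 m_gt0) -[RHS](card_imset _ (mulIf nz_v)).
  apply: eq_card => u; rewrite -[u in RHS](divfK nz_v) (mem_imset _ _ (mulIf nz_v)).
  have nz_vm : w ^+ (c * g) != 0 by rewrite -vm expf_neq0.
  rewrite !inE exprMn exprVn vm -[in RHS](inj_eq (mulIf nz_vm)) mul1r divfK //.
  by rewrite !in_circle exprMn exprVn (circleP _ Uv) invr1 mulr1.
rewrite mul0n; apply/eqP; rewrite cards_eq0; apply/set0Pn => -[u].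
rewrite inE => /andP[/circle_prim[j ->]]; rewrite -exprM (eq_prim_root_expr w_prim).
move=> /eqP ji; case/negP: ndvd.
rewrite /dvdn -(modn_dvdm i g_q) -ji (modn_dvdm _ g_q).
by rewrite -/(dvdn _ _) dvdn_mull ?dvdn_gcdl.
Qed.


Hypotheses (k_gt1 : (1 < k)%N) (k_coprime : coprime (2 * k - 1) q.+1).

Lemma circle_exp_eq1 u : u \in circle -> u ^+ (2 * k - 1) = 1 -> u = 1.
Proof.
move=> Uu u1; apply: (circle_coprime_inj k_coprime) => //; first exact: circle1.
by rewrite /= u1 expr1n.
Qed.

(** For [a = 0] the equation reads u^(2k-1) = -1; as [2 * k - 1] is odd and coprime to [q + 1], only
    -1 solves it. *)
Lemma card_niho_roots0 : #|niho_roots 0| = 1%N.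
Proof.
apply/eqP/cards1P; exists (-1); apply/setP=> u; rewrite !inE.
rewrite /niho_eq /niho_fun add0r expr0n gtn_eqF ?(ltnW q_gt1) //= mul0r.
apply/andP/eqP=> [[Uu /eqP u0]|->]; last first.
  rewrite circleN circle1; split=> //.
  by rewrite invrN invr1 mulN1r subrr.
apply: oppr_inj; rewrite opprK; apply: circle_exp_eq1; first by rewrite circleN.
have nz_u := circle_neq0 Uu.
have odd_k : odd (2 * k - 1) by lia.
rewrite exprNn -signr_odd odd_k mulN1r; apply/eqP; rewrite eqr_oppLR -addr_eq0.
apply/eqP; rewrite -[RHS](mul0r (u ^+ k.-1)) -u0 mulrDl mulrAC -exprS -exprD.
rewrite prednK ?(ltnW k_gt1) // -exprMn divff // expr1n; congr (u ^+ _ + 1); lia.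
Qed.

(** Here [a ^+ q] is 1/a, and the product of u^k and u^(1-k) is [u]; so the difference of the two
    sides is -1/a times (u^k - a)(u^(1-k) - a). *)
Lemma niho_eq_circle a u : a \in circle -> u \in circle ->
  niho_eq a u = (u ^+ k == a) || (u^-1 ^+ k.-1 == a).
Proof.
move=> Ua Uu; have [nz_a nz_u] := (circle_neq0 Ua, circle_neq0 Uu).
have uV : u * u^-1 ^+ k = u^-1 ^+ k.-1.
  by rewrite -[in LHS](prednK (ltnW k_gt1)) exprS mulrA divff ?mul1r.
have uk : u ^+ k * u^-1 ^+ k.-1 = u.
  by rewrite -uV mulrCA -exprMn divff // expr1n mulr1.
rewrite /niho_eq /niho_fun (circle_conj Ua) -subr_eq0 uV.
rewrite -[in X in _ || X]subr_eq0 -[in X in X || _]subr_eq0 -mulf_eq0.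
rewrite -[RHS](mulrI_eq0 _ (mulfI (_ : - a^-1 != 0))) ?oppr_eq0 ?invr_eq0 //.
congr (_ == 0); rewrite mulrBl !mulrBr uk.
by field.
Qed.

(** The roots are the union of the solution sets of the two factors. A common solution satisfies
    u^(2k-1) = 1, so it is [u = 1] and occurs only at [w ^+ i = 1]; this is the correction on the
    left. *)
Lemma card_niho_roots_circle i :
  (#|niho_roots (w ^+ i)| + (w ^+ i == 1%R) =
   (gcdn k q.+1 %| i) * gcdn k q.+1 + (gcdn k.-1 q.+1 %| i) * gcdn k.-1 q.+1)%N.
Proof.
have k1_gt0 : (0 < k.-1)%N by lia.
set a := w ^+ i; have Ua : a \in circle := prim_circle i.
rewrite -!card_circle_roots ?(ltnW k_gt1) // -/a.
have -> : #|[set u in circle | u ^+ k.-1 == a]| =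
    #|[set u in circle | u^-1 ^+ k.-1 == a]|.
  rewrite -(card_imset _ (@invr_inj L)); apply: eq_card => u.
  by rewrite -[u in LHS]invrK (mem_imset _ _ (@invr_inj L)) !inE circleV.
rewrite -cardsUI; congr (_ + _)%N.
  apply: eq_card => u; rewrite !inE -andb_orr.
  by case Uu: (u \in circle) => //=; rewrite niho_eq_circle.
have common u : u \in circle -> u ^+ k = a -> u^-1 ^+ k.-1 = a -> u = 1.
  move=> Uu uk uk1; apply: circle_exp_eq1 => //.
  have : u ^+ k / u^-1 ^+ k.-1 = 1 by rewrite uk uk1 divff // circle_neq0.
  by rewrite -exprVn invrK -exprD => <-; congr (_ ^+ _); lia.
have [a1|nz_a1] := eqVneq a 1.
  apply/esym/eqP/cards1P; exists 1; apply/setP=> u.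
  rewrite !inE; apply/idP/eqP=> [|->]; last by rewrite invr1 !expr1n a1 circle1 eqxx.
  by case/andP=> /andP[Uu /eqP uk] /andP[_ /eqP uk1]; apply: common.
apply/esym/eqP; rewrite cards_eq0 -subset0; apply/subsetP=> u.
rewrite !inE => /andP[/andP[Uu /eqP uk] /andP[_ /eqP uk1]].
by rewrite -uk (common u) // expr1n eqxx in nz_a1.
Qed.


(** * Triples of concurrent lines *)

Definition concurrent (x y t : L) : bool :=
  [exists a, [&& niho_eq a (t * x), niho_eq a (t * y) & niho_eq a t]].

(* Eliminating [a] leaves [t^k A + t^(1-k) B = 0] with [A] and [B] depending only
   on [x] and [y]. *)
Lemma concurrent_uniq x y t t' :
  x \in circle -> y \in circle -> t \in circle -> t' \in circle ->
  x != 1 -> y != 1 -> x != y -> concurrent x y t -> concurrent x y t' ->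
  [\/ t = t', x ^+ k = 1 /\ y ^+ k = 1 | x ^+ k.-1 = 1 /\ y ^+ k.-1 = 1].
Proof.
move=> Ux Uy Ut Ut' x1 y1 xy ct ct'.
have k2 : (2 * k - 1).+1 = (k + k)%N by lia.
set X := x ^+ k; set X' := x * x^-1 ^+ k.
set Y := y ^+ k; set Y' := y * y^-1 ^+ k.
pose A := (X - 1) * (y - 1) - (Y - 1) * (x - 1).
pose B := (X' - 1) * (y - 1) - (Y' - 1) * (x - 1).
have AB s : concurrent x y s -> s ^+ k * A + s * s^-1 ^+ k * B = 0.
  case/existsP=> a; rewrite /niho_eq /niho_fun => /and3P[/eqP ex /eqP ey /eqP e1].
  have {}ex : s ^+ k * X + s * s^-1 ^+ k * X' = a + a ^+ q * (s * x).
    by rewrite -ex /X /X' invfM !exprMn; ring.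
  have {}ey : s ^+ k * Y + s * s^-1 ^+ k * Y' = a + a ^+ q * (s * y).
    by rewrite -ey /Y /Y' invfM !exprMn; ring.
  transitivity ((s ^+ k * X + s * s^-1 ^+ k * X' - (s ^+ k + s * s^-1 ^+ k)) * (y - 1)
     - (s ^+ k * Y + s * s^-1 ^+ k * Y' - (s ^+ k + s * s^-1 ^+ k)) * (x - 1)).
    by rewrite /A /B; ring.
  by rewrite ex ey e1; ring.
have unit_kV s : s \in circle -> s ^+ k * s^-1 ^+ k = 1.
  by move/circle_neq0 => nz_s; rewrite -exprMn divff ?expr1n.
have [A0|nzA] := eqVneq A 0; last first.
  constructor 1; apply: (circle_coprime_inj k_coprime) => //=.
  have nz_t := circle_neq0 Ut; have nz_t' := circle_neq0 Ut'.
  (* Multiplying the relation by s^(k-1) isolates a power of [s] that is injective on the circle. *)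
  have e s : s \in circle -> concurrent x y s -> s ^+ (2 * k - 1) * A = - B.
    move=> Us cs; have nz_s := circle_neq0 Us.
    apply: (mulfI nz_s); rewrite mulrA -exprS.
    rewrite k2 exprD.
    have := congr1 (fun z => s ^+ k * z) (AB s cs).
    rewrite mulr0 mulrDr => /eqP; rewrite addr_eq0 mulrA => /eqP->.
    rewrite mulrN; congr (- _).
    by rewrite !mulrA [_ * s]mulrC -[s * _ * _]mulrA unit_kV // mulr1.
  by apply: (mulIf nzA); rewrite !e.
have B0 : B = 0.
  have := AB t ct; rewrite A0 mulr0 add0r => /eqP; rewrite !mulf_eq0.
  by rewrite expf_eq0 invr_eq0 (negPf (circle_neq0 Ut)) andbF /= => /eqP.
(* [A = B = 0]: [X - 1] and [X' - 1] have the ratios [c], [c'] to [x - 1], and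
   [Y - 1], [Y' - 1] the same ratios to [y - 1]; then [X X' = x], [Y Y' = y]
   force [c c' = 0] and [c + c' = 1]. *)
have XX : X * X' = x by rewrite /X /X' mulrCA unit_kV ?mulr1.
have YY : Y * Y' = y by rewrite /Y /Y' mulrCA unit_kV ?mulr1.
have nzx : x - 1 != 0 by rewrite subr_eq0.
have nzy : y - 1 != 0 by rewrite subr_eq0.
pose c := (X - 1) / (x - 1); pose c' := (X' - 1) / (x - 1).
have EX : X = 1 + c * (x - 1) by rewrite divfK // addrC subrK.
have EX' : X' = 1 + c' * (x - 1) by rewrite divfK // addrC subrK.
have EY : Y = 1 + c * (y - 1).
  apply: (mulIf nzx); apply/eqP; rewrite -subr_eq0; apply/eqP.
  by transitivity (- A); [rewrite /A EX; ring | rewrite A0 oppr0].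
have EY' : Y' = 1 + c' * (y - 1).
  apply: (mulIf nzx); apply/eqP; rewrite -subr_eq0; apply/eqP.
  by transitivity (- B); [rewrite /B EX'; ring | rewrite B0 oppr0].
have cx : c + c' + c * c' * (x - 1) = 1.
  apply: (mulIf nzx); rewrite mul1r -[in RHS]XX EX EX'; ring.
have cy : c + c' + c * c' * (y - 1) = 1.
  apply: (mulIf nzy); rewrite mul1r -[in RHS]YY EY EY'; ring.
have : c * c' * (x - y) == 0.
  apply/eqP; transitivity ((c + c' + c * c' * (x - 1)) - (c + c' + c * c' * (y - 1))).
    ring.
  by rewrite cx cy subrr.
have exp_pred s : s \in circle -> s * s^-1 ^+ k = 1 -> s ^+ k.-1 = 1.
  move=> Us s1; have sk : s ^+ k = s.
    by rewrite -[LHS]mulr1 -[X in _ * X = _]s1 mulrCA unit_kV ?mulr1.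
  by apply: (mulfI (circle_neq0 Us)); rewrite -exprS prednK ?(ltnW k_gt1) // sk mulr1.
rewrite mulf_eq0 subr_eq0 (negPf xy) orbF mulf_eq0 => /orP[/eqP c0|/eqP c0].
  by constructor 2; rewrite -/X -/Y EX EY c0 !mul0r addr0.
constructor 3; split; apply: exp_pred => //.
  by rewrite -/X' EX' c0 mul0r addr0.
by rewrite -/Y' EY' c0 mul0r addr0.
Qed.

(** The numerical hypothesis compares an upper and a lower bound for the number of concurrent
    triples, both divided by [q + 1]. *)
Lemma exists_few_niho_roots e :
  (2 <= e)%N ->
  (q.+1 + gcdn k q.+1 ^ 2 + gcdn k.-1 q.+1 ^ 2 < (e - 2) * q)%N ->
  exists a, (2 <= #|niho_roots a| < e)%N.
Proof.
move=> e_ge2 lt_e; suff /existsP[a] : [exists a, 2 <= #|niho_roots a| < e]%N.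
  by exists a.
apply: contraT => /existsPn/= no_a.
pose T x y t := [&& x != 1, y != 1, x != y & concurrent x y t].
(* For each [t] and each [x != 1] the lines of [t * x] and [t] meet in a point, through which at
   least [e - 2] further lines pass. *)
have : (q.+1 * (q * (e - 2)) <=
    \sum_(t in circle) \sum_(x in circle) \sum_(y in circle) T x y t)%N.
  rewrite -card_circle -sum_nat_const; apply: leq_sum => t Ut.
  have cardU1 : #|circle :\ 1| = q.
    by have := cardsD1 1 circle; rewrite circle1 card_circle => -[].
  rewrite -[X in (X * _ <= _)%N]cardU1 -sum_nat_const.
  rewrite [X in (_ <= X)%N](bigD1 1) ?circle1 //=.
  rewrite (leq_trans _ (leq_addl _ _)) //.
  rewrite [X in (_ <= X)%N](eq_bigl (mem (circle :\ 1))) => [|x]; last first.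
    by rewrite !inE andbC.
  apply: leq_sum => x; rewrite !inE => /andP[x1 Ux].
  have nz_t := circle_neq0 Ut.
  have neq_tx : t * x != t.
    by rewrite -subr_eq0 -[X in _ - X]mulr1 -mulrBr mulf_neq0 ?subr_eq0.
  have Utx : t * x \in circle by apply: circleM.
  have [a /setP aP] :
      exists a, [set b | niho_eq b (t * x) && niho_eq b t] = [set a].
    by apply/cards1P; rewrite card_niho_point.
  have := aP a; rewrite !inE eqxx => /andP[atx at_].
  have : (e - 2 <= #|niho_roots a :\ t :\ (t * x)%R|)%N.
    have := cardsD1 t (niho_roots a); have := cardsD1 (t * x) (niho_roots a :\ t).
    rewrite !inE neq_tx Ut Utx atx at_ /= => c1 c2.
    have := no_a a; rewrite c2 c1 !add1n /= -leqNgt.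
    by rewrite leq_subLR add2n.
  move=> le_e; apply: leq_trans le_e _.
  rewrite -big_mkcondr /= sum1dep_card -[leqRHS](card_imset _ (mulfI nz_t)).
  apply/subset_leq_card/subsetP=> v; rewrite !inE => /and4P[vtx vt Uv av].
  apply/imsetP; exists (t^-1 * v); last by rewrite mulVKf.
  rewrite inE circleM ?circleV //= /T x1 /=; apply/and3P; split.
  - by apply: contraNneq vt => v1; rewrite -(mulVKf nz_t v) v1 mulr1.
  - by apply: contraNneq vtx => ->; rewrite mulVKf.
  - by apply/existsP; exists a; rewrite mulVKf // atx av.
rewrite exchange_big /=.
under eq_bigr do rewrite exchange_big /=.
pose Ak m : {set L} := [set u in circle | u ^+ m == 1].
(* At most one [t] belongs to a pair, except for two [k]-th or two [(k - 1)]-th roots of unity,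
   where the trivial bound [q + 1] is used. *)
have bound x y : x \in circle -> y \in circle ->
    (\sum_(t in circle) T x y t <=
     1 + q.+1 * ((x \in Ak k) * (y \in Ak k) + (x \in Ak k.-1) * (y \in Ak k.-1)))%N.
  move=> Ux Uy; rewrite -big_mkcondr /= sum1dep_card.
  set S := [set _ | _]; rewrite !inE Ux Uy /=.
  have leS : (#|S| <= q.+1)%N.
    by rewrite -card_circle; apply/subset_leq_card/subsetP=> t; rewrite inE => /andP[].
  set b := (_ * _ + _ * _)%N; have [b0|b_gt0] := posnP b; last first.
    by rewrite (leq_trans leS) // (leq_trans _ (leq_addl _ _)) // leq_pmulr.
  rewrite b0 muln0 addn0; apply/card_le1P=> t.
  rewrite inE => /andP[Ut /and4P[x1 y1 xy ct]].
  move=> t'; rewrite !inE; apply/andP/eqP=> [[Ut' /and4P[_ _ _ ct']]|->]; last first.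
    by rewrite Ut /T x1 y1 xy.
  have [//|[xk yk]|[xk yk]] := concurrent_uniq Ux Uy Ut' Ut x1 y1 xy ct' ct.
    by rewrite /b xk yk eqxx in b0.
  by rewrite /b xk yk eqxx addnC in b0.
suff le_S : (\sum_(x in circle) \sum_(y in circle) \sum_(t in circle) T x y t <=
    q.+1 * q.+1 + q.+1 * (gcdn k q.+1 ^ 2 + gcdn k.-1 q.+1 ^ 2))%N.
  move/leq_trans/(_ le_S); rewrite -mulnDr leq_pmul2l // => le1.
  by move: lt_e; rewrite mulnC; lia.
apply: leq_trans (_ : (\sum_(x in circle) \sum_(y in circle) (1 + q.+1 *
    ((x \in Ak k) * (y \in Ak k) + (x \in Ak k.-1) * (y \in Ak k.-1))) <= _)%N).
  by apply: leq_sum => x Ux; apply: leq_sum => y Uy; apply: bound.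
have sumAk m : (0 < m)%N -> (\sum_(x in circle) (x \in Ak m) = gcdn m q.+1)%N.
  move=> m_gt0; rewrite -card_circle_roots1 // -big_mkcondr sum1dep_card.
  by apply: eq_card => u; rewrite !inE andbA andbb.
under eq_bigr => x _.
  rewrite big_split /= sum1_card card_circle -big_distrr big_split /=.
  rewrite -!big_distrr /= !sumAk ?(ltnW k_gt1) //; last by lia.
  over.
rewrite big_split /= sum_nat_const card_circle -big_distrr big_split /=.
rewrite -!big_distrl /= !sumAk ?(ltnW k_gt1) ?mulnn //; lia.
Qed.

End PrimRoot.

End UnitCircle.

(** * Weil sums in terms of root counts *)

Section WeilSum.

Variables (R : realType) (p n q : nat) (L : finFieldType).
Variables (charL : p \in [pchar L]) (p_odd : odd p) (n_gt0 : (0 < n)%N).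
Hypothesis q_def : q = (p ^ n)%N.
Hypothesis cardL : #|L| = (q ^ 2)%N.
Local Notation mu := (add_char R charL).
Local Notation tr := (abs_trace charL).

Let p_pr : prime p. Proof. exact: pcharf_prime charL. Qed.

Let q_gt1 : (1 < q)%N.
Proof. by rewrite q_def -(exp1n n) ltn_exp2r // prime_gt1. Qed.

Let q1_gt0 : (0 < q.-1)%N.
Proof. by rewrite -ltnS prednK // ltnW. Qed.

Let q_odd : odd q.
Proof. by rewrite q_def oddX p_odd orbT. Qed.

Lemma expr_pchar_powD : {morph (fun x : L => x ^+ q) : x y / x + y}.
Proof.
move=> x y; apply: exprDn_pchar; rewrite q_def pnatX; apply/orP; left.
by rewrite pnatE.
Qed.
Let conjD := expr_pchar_powD.

(** The subfield F of order [q], as a subset of [L]. *)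
Definition conj_fixed : {set L} := [set r | r ^+ q == r].
Local Notation K := conj_fixed.

Lemma conj_fixedE : K = 0 |: [set r : L | r ^+ q.-1 == 1].
Proof.
apply/setP=> r; rewrite !inE; have [->|nz_r] /= := eqVneq r 0.
  by rewrite expr0n gtn_eqF ?(ltnW q_gt1) // eqxx.
by rewrite -[in LHS](prednK (ltnW q_gt1)) exprS -[RHS](inj_eq (mulfI nz_r)) mulr1.
Qed.

Lemma card_conj_fixed : #|K| = q.
Proof.
rewrite conj_fixedE cardsU1 (card_circle_fiber q_gt1 cardL) ?circle1 //.
by rewrite inE expr0n gtn_eqF //= eq_sym oner_eq0 add1n prednK // ltnW.
Qed.

Lemma Fp_double_eq0 (c : 'F_p) : (c + c == 0) = (c == 0).
Proof.
rewrite -mulr2n -mulr_natr mulf_eq0 -(dvdn_pcharf (pchar_Fp p_pr)).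
by rewrite gtnNdvd ?orbF // odd_prime_gt2.
Qed.

(** [r * z] and its conjugate have the same absolute trace. Doubling, which is injective in odd
    characteristic, thus expresses the trace through z + z^q. *)
Lemma abs_trace_conj_sum (r z : L) : r \in K ->
  tr (r * z) + tr (r * z) = tr (r * (z + z ^+ q)).
Proof.
rewrite inE => /eqP rK; rewrite mulrDr abs_traceD; congr (_ + _).
by rewrite -[LHS](abs_trace_Frobenius_iter charL n) -q_def exprMn rK.
Qed.

Lemma sum_add_char_fixed z :
  \sum_(r in K) mu (r * z) = if z + z ^+ q == 0 then q%:R else 0.
Proof.
case: eqP => [z0|/eqP nz].
  rewrite -card_conj_fixed -sumr_const; apply: eq_bigr => r Kr.
  apply/eqP; rewrite add_char_eq1 // -Fp_double_eq0.
  by rewrite abs_trace_conj_sum // z0 mulr0 abs_trace0.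
have KB r s : r \in K -> s \in K -> r + s \in K.
  by rewrite !inE conjD => /eqP-> /eqP->.
have conj_add x : x + x ^+ q \in K by rewrite inE conjD (conjK cardL) addrC.
have [x nz_x] := abs_trace_neq0 charL.
(* With this choice [r0 * z] has the same trace as [x], so [mu (r0 * z)] differs from 1; shifting by
   [r0] then forces the sum to vanish. *)
pose r0 := (x + x ^+ q) / (z + z ^+ q).
have Kr0 : r0 \in K.
  have := conj_add x; have := conj_add z; rewrite !inE exprMn exprVn.
  by move=> /eqP-> /eqP->.
have mu1 : mu (r0 * z) != 1.
  rewrite add_char_eq1 // -Fp_double_eq0 abs_trace_conj_sum // divfK //.
  by rewrite -[x + _]mul1r -abs_trace_conj_sum ?mul1r ?Fp_double_eq0 // inE expr1n.
set S := \sum_(r in K) _.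
have : S = mu (r0 * z) * S.
  rewrite [LHS](reindex_inj (addrI r0)) /= big_distrr /=.
  apply: eq_big => r => [|_]; last by rewrite mulrDl add_charD.
  apply/idP/idP=> [Kr|]; last exact: KB.
  have := KB _ _ (_ : - r0 \in K) Kr; rewrite addKr; apply.
  by move: Kr0; rewrite !inE conjN // => /eqP->.
move/eqP; rewrite -subr_eq0 -{1}[S]mul1r -mulrBl mulf_eq0 subr_eq0 eq_sym.
by rewrite (negPf mu1) => /eqP.
Qed.

Variable k : nat.
Local Notation s := (1 + k * (q - 1))%N.

(** With u = y^(q-1) one has y^q = y u and y^s = y u^k, so the left side is [y] times the difference
    of the sides of the Niho equation. *)
Lemma niho_exp_conj (a y : L) : y != 0 ->
  (y ^+ s - a * y + (y ^+ s - a * y) ^+ q == 0) = niho_eq q k a (y ^+ q.-1).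
Proof.
move=> nz_y; set u := y ^+ q.-1.
have Uu : u \in circle L q := expr_circle q_gt1 cardL nz_y.
have yq : y ^+ q = y * u by rewrite -exprS prednK ?(ltnW q_gt1).
have ys : y ^+ s = y * u ^+ k by rewrite exprD expr1 mulnC exprM subn1.
have -> : y ^+ s - a * y + (y ^+ s - a * y) ^+ q =
    y * (niho_fun k u - (a + a ^+ q * u)).
  rewrite conjB // ys !exprMn yq [_ ^+ k ^+ q]exprAC (circle_conj Uu) /niho_fun; ring.
by rewrite mulf_eq0 (negPf nz_y) subr_eq0.
Qed.

(** For nonzero [r] in F, r^s = r, so scaling [x] by [r] and summing over [r] leads to
    [sum_add_char_fixed] minus its term at 0. Each root is y^(q-1) for [q - 1] values of [y]. The
    identity is proved after multiplication by [q - 1]. *)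
Lemma weil_sum_niho (a : L) :
  weil_sum R charL s a = (#|niho_roots q k a|%:R - 1) * q%:R.
Proof.
rewrite /weil_sum (bigD1 0) //= expr0n mulr0 subrr add_char0.
pose f x := mu (x ^+ s - a * x); rewrite -/f.
have nzq1 : (q.-1)%:R != 0 :> R[i] by rewrite pnatr_eq0 -lt0n.
apply: (mulfI nzq1).
have Kf r : r \in K -> r != 0 ->
    \sum_(x | x != 0) f x = \sum_(y | y != 0) mu (r * (y ^+ s - a * y)).
  rewrite conj_fixedE !inE => Kr nz_r; rewrite (negPf nz_r) /= in Kr.
  rewrite (reindex_inj (mulfI nz_r)) /=; apply: eq_big => y.
    by rewrite mulf_eq0 (negPf nz_r).
  move=> _; rewrite /f exprMn [r ^+ s]exprD expr1 mulnC exprM subn1 (eqP Kr).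
  by rewrite expr1n mulr1 mulrBr mulrCA.
have sumK : \sum_(r in K | r != 0) \sum_(x | x != 0) f x =
    q.-1%:R * \sum_(x | x != 0) f x.
  rewrite sumr_const mulr_natl; congr (_ *+ _).
  have := cardsD1 0 K; rewrite card_conj_fixed inE expr0n gtn_eqF ?(ltnW q_gt1) //.
  rewrite eqxx add1n => /(congr1 predn)/= ->; apply: eq_card => r.
by rewrite -topredE /= !inE andbC.
have sumC : \sum_(r in K | r != 0) \sum_(x | x != 0) f x =
    \sum_(y | y != 0) ((niho_eq q k a (y ^+ q.-1))%:R * q%:R - 1).
  transitivity (\sum_(y | y != 0) \sum_(r in K | r != 0) mu (r * (y ^+ s - a * y))).
    rewrite [RHS]exchange_big /=; apply: eq_bigr => r /andP[Kr nz_r]; exact: Kf.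
  apply: eq_bigr => y nz_y; apply: (addIr 1); rewrite subrK -niho_exp_conj //.
  have := sum_add_char_fixed (y ^+ s - a * y).
  rewrite (bigD1 0) /=; last by rewrite inE expr0n gtn_eqF ?(ltnW q_gt1).
  rewrite mul0r add_char0 addrC => ->.
  by case: eqP; rewrite ?mul1r ?mul0r.
have cardN : (\sum_(y : L | y != 0%R) niho_eq q k a (y ^+ q.-1) =
    q.-1 * #|niho_roots q k a|)%N.
  rewrite (partition_big (fun y => y ^+ q.-1) [in circle L q]) /=; last first.
    by move=> y; apply: expr_circle.
  rewrite -sum1dep_card big_mkcondr big_distrr /=; apply: eq_bigr => u Uu.
  rewrite -[X in _ = (X * _)%N](card_circle_fiber q_gt1 cardL Uu) -sum1dep_card.
  rewrite big_distrl /=.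
  apply: eq_big => y; last first.
    by move=> /andP[_ /eqP->]; rewrite mul1n; case: niho_eq.
  case: eqVneq => [->|//] /=; apply/esym; apply: contraTF Uu => /eqP <-.
  by rewrite in_circle expr0n gtn_eqF // expr0n /= eq_sym oner_eq0.
rewrite mulrDr mulr1 -sumK sumC sumrB -big_distrl /= -natr_sum cardN sumr_const.
have -> : #|[pred y : L | y != 0]| = (q ^ 2).-1.
  by rewrite -cardL -(cardsC1 (0 : L)); apply: eq_card => y; rewrite !inE.
have -> : ((q ^ 2).-1 = q.-1 * q.+1)%N by nia.
have {5}-> : q = q.-1.+1 by lia.
rewrite !natrM -!natr1; ring.
Qed.

End WeilSum.

(** * Five root counts, and the resulting Weil spectrum *)

(** A count [m] stands for the Weil value (m - 1) q, so an odd [m >= 3] yields a positive even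
    multiple of [q] and an even [m' >= 4] an odd multiple that is at least 3. *)
Lemma niho_spectrum_values (p n q k : nat) (L : finFieldType)
    (charL : p \in [pchar L]) :
  odd p -> (2 <= n)%N -> q = (p ^ n)%N -> #|L| = (q ^ 2)%N ->
  (2 <= k)%N -> (2 * k <= p + 1)%N -> coprime (2 * k - 1) q.+1 ->
  (5 <= gcdn k q.+1 + gcdn k.-1 q.+1)%N ->
  exists v : seq nat,
    [/\ uniq v, size v = 5%N,
        {in v, forall m, exists2 a : L, a != 0 & #|niho_roots q k a| = m},
        [/\ 0%N \in v & 1%N \in v] &
        exists2 m, odd m && (3 <= m)%N &
        exists2 m', ~~ odd m' && (4 <= m')%N & (m \in v) && (m' \in v)].
Proof.
move=> p_odd n_ge2 q_def cardL k_ge2 le_kp co_k d_ge5.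
have p_gt2 : (2 < p)%N by rewrite odd_prime_gt2 // (pcharf_prime charL).
have le_pq : (p ^ 2 <= q)%N by rewrite q_def leq_pexp2l //; lia.
have q_gt1 : (1 < q)%N by nia.
have q_odd : odd q by rewrite q_def oddX p_odd orbT.
have n_gt0 : (0 < n)%N by lia.
have conjD := @expr_pchar_powD p n q L charL q_def.
have [w w_prim] := circle_prim_root q_gt1 cardL.
have k1_gt0 : (0 < k.-1)%N by lia.
set d1 := gcdn k q.+1 in d_ge5 *; set d2 := gcdn k.-1 q.+1 in d_ge5 *.
pose N (a : L) := #|niho_roots q k a|.
have N0 : N 0 = 1%N by apply: card_niho_roots0 w_prim k_ge2 co_k.
have Nw i : (N (w ^+ i) + (w ^+ i == 1%R) = (d1 %| i) * d1 + (d2 %| i) * d2)%N.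
  exact: card_niho_roots_circle.
have d12 : coprime d1 d2.
  rewrite /coprime -dvdn1 -(_ : gcdn k k.-1 = 1)%N.
    by rewrite dvdn_gcd (dvdn_trans (dvdn_gcdl _ _)) ?dvdn_gcdl //
      (dvdn_trans (dvdn_gcdr _ _)) ?dvdn_gcdl.
  by apply/eqP; rewrite -{1}(prednK (ltnW k_ge2)) -[_ == _]/(coprime _ _) coprimeSn.
have d1_le : (d1 <= k)%N by rewrite dvdn_leq ?dvdn_gcdl //; lia.
have d2_le : (d2 <= k.-1)%N by rewrite dvdn_leq ?dvdn_gcdl.
have d1_gt0 : (0 < d1)%N by rewrite gcdn_gt0 orbT.
have d2_gt0 : (0 < d2)%N by rewrite gcdn_gt0 orbT.
have N1 : N 1 = (d1 + d2).-1.
  have := Nw 0%N; rewrite expr0 eqxx !dvdn0; lia.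
(* As [q + 1] is even, taking the gcd with it preserves parity, and [k], [k - 1] have opposite
   parities. *)
have odd_d : odd (d1 + d2).
  have odd_gcd m : odd (gcdn m q.+1) = odd m.
    by apply: negb_inj; rewrite -!dvdn2 dvdn_gcd [X in _ && X]dvdn2 /= q_odd andbT.
  by rewrite oddD !odd_gcd -{1}(prednK (ltnW k_ge2)) /= addNb addbb.
have k_pred : (k.-1 + 1 = k)%N by rewrite addn1 prednK // ltnW.
have wX_neq1 i : (0 < i <= k)%N -> (w ^+ i == 1) = false.
  by move=> lt_i; rewrite -(prim_order_dvd w_prim) gtnNdvd //; nia.
have Nk : N (w ^+ k) = (d1 + (d2 == 1%N))%N.
  have := Nw k; rewrite dvdn_gcdl wX_neq1 ?(ltnW k_ge2) //= mul1n addn0 => ->.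
  rewrite -[X in (d2 %| X)%N]k_pred dvdn_addr ?dvdn_gcdl // dvdn1.
  by case: eqP => [->|].
have Nk1 : N (w ^+ k.-1) = (d2 + (d1 == 1%N))%N.
  have := Nw k.-1; rewrite dvdn_gcdl wX_neq1 ?k1_gt0 ?leq_pred //= mul1n addn0 => ->.
  rewrite (@dvdn_add_eq d1 k.-1 1) ?k_pred ?dvdn_gcdl // dvdn1 addnC.
  by case: eqP => [->|].
pose attained m := exists2 a : L, a != 0 & N a = m.
have attain i m : N (w ^+ i) = m -> attained m.
  by exists (w ^+ i) => //; rewrite (circle_neq0 (prim_circle w_prim i)).
(* Since [N 0 = 1], any other count can only come from a nonzero [a]. *)
have att_no1 a m : m != 1%N -> N a = m -> attained m.
  by move=> m1 Na; exists a => //; apply: contraNneq m1 => a0; rewrite -Na a0 N0.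
have att0 : attained 0%N.
  have [|a Na] := exists_no_niho_root q_gt1 cardL q_odd conjD k_ge2; first by nia.
  exact: att_no1 Na.
have att1 : attained 1%N.
  apply: (exists_single_niho_root q_gt1 cardL q_odd conjD N0 (b := 1)).
  by rewrite -/(N 1) N1; lia.
have attM : attained (d1 + d2).-1 by apply: (attain 0%N); rewrite expr0.
have [one_d|] := boolP ((d1 == 1%N) || (d2 == 1%N)); last first.
  rewrite negb_or => /andP[d1_neq1 d2_neq1].
  have neq_d : d1 != d2.
    by apply: contraNneq d1_neq1 => d1E; rewrite -d1E /coprime gcdnn in d12.
  exists [:: 0%N; 1%N; d1; d2; (d1 + d2).-1]; split=> //.
  - by rewrite /= !inE; lia.
  - move=> x; rewrite !inE => /orP[|/or4P[]] /eqP-> //.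
      by apply: (attain k); rewrite Nk (negPf d2_neq1) addn0.
    by apply: (attain k.-1); rewrite Nk1 (negPf d1_neq1) addn0.
  (* Exactly one of [d1], [d2] is odd, and being different from 1 it is at least 3. *)
  have even_M : ~~ odd (d1 + d2).-1 && (4 <= (d1 + d2).-1)%N by lia.
  case odd_d1: (odd d1).
    by exists d1; [lia | exists (d1 + d2).-1; rewrite // !inE !eqxx !orbT].
  by exists d2; [lia | exists (d1 + d2).-1; rewrite // !inE !eqxx !orbT].
(* One of [d1], [d2] is 1, so [d] is the other one. *)
set d := (d1 + d2).-1 in attM.
have d_succ : d.+1 = (d1 + d2)%N by rewrite prednK // addn_gt0 d1_gt0.
have attS : attained d.+1.
  rewrite d_succ; case/orP: one_d => /eqP d_1.
    by apply: (attain k.-1); rewrite Nk1 d_1 addnC.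
  by apply: (attain k); rewrite Nk d_1.
have sq_d : (d1 ^ 2 + d2 ^ 2 = d ^ 2 + 1)%N.
  by rewrite /d; case/orP: one_d => /eqP->; rewrite ?addn1 // addnC.
have d_le : (d <= k)%N by case/orP: one_d => /eqP d_1; lia.
have d_ge4 : (4 <= d)%N by lia.
have even_d : ~~ odd d by rewrite -oddS d_succ.
have [m lt_m attm] : exists2 m, (2 <= m < d)%N & attained m.
  (* From [d <= k], [2 * k <= p + 1] and [p ^ 2 <= q]. It makes the required left side q + d^2 + 2
     smaller than 2 q, while [d >= 4] gives 2 q <= (d - 2) q. *)
  have lt_d : (d ^ 2 + 3 <= q)%N by nia.
  have [||a Na] := @exists_few_niho_roots L q q_gt1 cardL q_odd conjD k w
                     w_prim k_ge2 co_k d.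
  - by lia.
  - rewrite -/d1 -/d2 -addnA sq_d.
    have : (2 * q <= (d - 2) * q)%N by rewrite leq_mul2r; lia.
    by lia.
  by exists (N a) => //; apply: (att_no1 a) => //; rewrite /N; lia.
exists [:: 0%N; 1%N; m; d; d.+1]; split=> //.
- by rewrite /= !inE; lia.
- by move=> x; rewrite !inE => /orP[|/or4P[]] /eqP->.
- exists d.+1; first by rewrite /= even_d; lia.
  by exists d; rewrite ?even_d ?d_ge4 // !inE !eqxx !orbT.
Qed.

Theorem theorem1p10 (R : realType) (p n k : nat) (F L : finFieldType)
    (iota : {rmorphism F -> L}) (charL : p \in [pchar L])
    (p_prime : prime p) (p_odd : odd p) (n_ge2 : (2 <= n)%N)
    (cardF : #|F| = (p ^ n)%N) (cardL : #|L| = (p ^ (2 * n))%N)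
    (k_ge2 : (2 <= k)%N) (k_lt : k%:R < p%:R / 2 + 1 :> rat)
    (s_inv : invertible_exponent p n (1 + k * (p ^ n - 1))%N)
    (s_niho : niho_exponent p n (1 + k * (p ^ n - 1))%N)
    (d_ge5 : (5 <= gcdn k (p ^ n + 1) + gcdn (k - 1) (p ^ n + 1))%N) :
  let spec := weil_spectrum R charL (1 + k * (p ^ n - 1))%N in
  (5 <= #|` spec|)%N /\
  exists alpha beta : nat,
    [/\ (1 <= alpha)%N, (1 <= beta)%N &
     [/\ 0 \in spec, - (p ^ n)%:R \in spec,
         (2 * alpha * p ^ n)%:R \in spec &
         ((2 * beta + 1) * p ^ n)%:R \in spec]].
Proof.
have sqr_q : (p ^ (2 * n) = (p ^ n) ^ 2)%N by rewrite mulnC expnM.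
rewrite /invertible_exponent sqr_q in s_inv; rewrite sqr_q in cardL.
have q_gt0 : (0 < p ^ n)%N by rewrite expn_gt0 prime_gt0.
have le_kp : (2 * k <= p + 1)%N.
  have : (2 * k)%:R < (p + 2)%:R :> rat by rewrite natrM natrD; lra.
  by rewrite ltr_nat; lia.
clear cardF s_niho sqr_q.
move q_def: (p ^ n)%N s_inv d_ge5 cardL q_gt0 => q s_inv d_ge5 cardL q_gt0.
(* The exponent is -(2k - 1) modulo [q + 1], and [q + 1] divides q^2 - 1, so invertibility passes to
   [2 * k - 1]. *)
have co_k : coprime (2 * k - 1) q.+1.
  have q1_dvd : (q.+1 %| q ^ 2 - 1)%N.
    by rewrite -(exp1n 2) subn_sqr addn1 dvdn_mull.
  have := coprime_dvdr q1_dvd s_inv.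
  rewrite /coprime => /eqP co_s; apply/eqP; rewrite -[RHS]co_s.
  have e : ((1 + k * (q - 1)) + (2 * k - 1) = k * q.+1)%N by nia.
  have dvd_sum d : (d %| q.+1 -> d %| 1 + k * (q - 1) + (2 * k - 1))%N.
    by rewrite e; apply: dvdn_mull.
  apply/eqP; rewrite eqn_dvd !dvdn_gcd !dvdn_gcdr !andbT; apply/andP; split.
    by rewrite (dvdn_add_eq (dvd_sum _ (dvdn_gcdr _ _))) dvdn_gcdl.
  by rewrite -(dvdn_add_eq (dvd_sum _ (dvdn_gcdr _ _))) dvdn_gcdl.
rewrite !addn1 subn1 in d_ge5.
have [v [uniq_v size_v att [v0 v1]]] :=
  niho_spectrum_values charL p_odd n_ge2 (esym q_def) cardL k_ge2 le_kp co_k d_ge5.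
case=> m /andP[odd_m m_ge3] [m' /andP[even_m' m'_ge4] /andP[vm vm']].
have n_gt0 : (0 < n)%N by apply: ltnW.
set spec := weil_spectrum _ _ _.
pose W m : R[i] := (m%:R - 1) * q%:R.
have specW x : x \in v -> W x \in spec.
  move=> /att[a nz_a Na]; apply/imfsetP; exists a => //.
  by rewrite (weil_sum_niho _ charL p_odd n_gt0 (esym q_def) cardL) Na.
have W_inj : injective W.
  move=> x y /mulIf-/(_ (_ : q%:R != 0))/addIr/eqP.
  by rewrite pnatr_eq0 -lt0n q_gt0 eqr_nat => /(_ isT)/eqP.
split.
  rewrite -size_v -(size_map W) uniq_leq_size ?map_inj_uniq //.
  by move=> _ /mapP[x vx ->]; apply: specW.
(* Solutions of 2 alpha = m - 1 and 2 beta + 1 = m' - 1. *)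
exists m./2, (m'./2).-1; split; [lia | lia | split].
- by have := specW _ v1; rewrite /W subrr mul0r.
- by have := specW _ v0; rewrite /W sub0r mulN1r.
- have := specW _ vm; rewrite /W.
  have {1}-> : m = (2 * m./2 + 1)%N by lia.
  by rewrite natrD addrK -natrM.
have := specW _ vm'; rewrite /W.
have {1}-> : m' = (2 * (m'./2).-1 + 1 + 1)%N by lia.
by rewrite natrD addrK -natrM.
Qed.
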